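(* Let $\mathbf{C}$ be either the class of all cancellative cones, or the class of all separative cones. Then any $\mathbf{C}$-strongly unitarily closed element of $\mathbf{C}$ is a refinement cone; if in addition it is $\mathbf{C}$-unitarily closed, then it is normally divisible.
   Context: Commutative monoids are written additively. The algebraic preordering of a commutative monoid $M$ is $x\le y\iff(\exists z\in M)(x+z=y)$. A cone is a commutative monoid that is conical: $x+y=0\Rightarrow x=y=0$. It is cancellative if $x+z=y+z\Rightarrow x=y$, and separative if $2x=x+y=2y\Rightarrow x=y$. A refinement cone is a cone with the refinement property: whenever $a_0+a_1=b_0+b_1$ there are $c_{ij}$ ($i,j<2$) with $a_i=c_{i0}+c_{i1}$ and $b_i=c_{0i}+c_{1i}$ for all $i<2$. A commutative monoid $M$ is normally divisible if for every positive integer $p$, every finite subset $X\subseteq M$ and every $a\in M$, there is $u\in M$ with $pu=a$ and, for all $x,y\in X$, $x+a=y+a\Rightarrow x+u=y+u$. A homomorphism $f:A\to B$ of commutative monoids is unitary if it is one-to-one, has cofinal image (every $b\in B$ satisfies $b\le f(a)$ for some $a\in A$), and for all $a_0,a_1\in A$, $b\in B$, $f(a_0)+b=f(a_1)$ implies $b\in f[A]$. It is strongly unitary if it is unitary and for all $m\in\mathbb{N}=\{1,2,\dots\}$ and $b\in B$, $mb\in f[A]$ implies $b\in f[A]$. If $A$ is a submonoid of $B$, then $B$ is a unitary (resp. strong unitary) extension of $A$ if the inclusion map is unitary (resp. strongly unitary). An equation system with parameters from $M$ is a finite set of equations, each of the form $\sum_{i<k}p_i\mathbf{x}_i+a=\sum_{i<k}q_i\mathbf{x}_i+b$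 with $k,p_i,q_i$ non-negative integers, $a,b\in M$, and $\mathbf{x}_i$ unknowns. An element $M$ of a class $\mathbf{C}$ is $\mathbf{C}$-unitarily closed (resp. $\mathbf{C}$-strongly unitarily closed) if every equation system with parameters from $M$ that has a solution in some unitary (resp. strong unitary) extension of $M$ belonging to $\mathbf{C}$ has a solution in $M$. *)

(* Defs.v *)
From Stdlib Require List.
From mathcomp Require Import all_boot all_algebra.

Set Implicit Arguments.
Unset Strict Implicit.
Unset Printing Implicit Defensive.

Import GRing.Theory.
Local Open Scope ring_scope.

(* Commutative monoids are nmodTypes. *)

Definition alg_le (M : nmodType) (x y : M) : Prop := exists z, x + z = y.

Definition is_cone (M : nmodType) : Prop :=
  forall x y : M, x + y = 0 -> x = 0 /\ y = 0.

Definition cancellative (M : nmodType) : Prop :=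
  forall x y z : M, x + z = y + z -> x = y.

Definition separative (M : nmodType) : Prop :=
  forall x y : M, x *+ 2 = x + y -> x + y = y *+ 2 -> x = y.

Definition cancellative_cone (M : nmodType) : Prop :=
  is_cone M /\ cancellative M.

Definition separative_cone (M : nmodType) : Prop :=
  is_cone M /\ separative M.

Definition refinement (M : nmodType) : Prop :=
  forall a0 a1 b0 b1 : M, a0 + a1 = b0 + b1 ->
    exists c00 c01 c10 c11 : M,
      [/\ a0 = c00 + c01, a1 = c10 + c11,
          b0 = c00 + c10 & b1 = c01 + c11].

Definition refinement_cone (M : nmodType) : Prop :=
  is_cone M /\ refinement M.

Definition normally_divisible (M : nmodType) : Prop :=
  forall (p : nat) (X : seq M) (a : M), (0 < p)%N ->
    exists u : M, u *+ p = a /\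
      forall x y, x \in X -> y \in X -> x + a = y + a -> x + u = y + u.

Definition in_image (A B : nmodType) (f : {additive A -> B}) (b : B) : Prop :=
  exists a, f a = b.

Definition unitary (A B : nmodType) (f : {additive A -> B}) : Prop :=
  [/\ injective f,
      forall b, exists a, alg_le b (f a)
    & forall (a0 a1 : A) (b : B), f a0 + b = f a1 -> in_image f b].

Definition strongly_unitary (A B : nmodType) (f : {additive A -> B}) : Prop :=
  unitary f /\
  forall (m : nat) (b : B), (0 < m)%N -> in_image f (b *+ m) -> in_image f b.

(* The equation  sum_(i < k) p_i x_i + a = sum_(i < k) q_i x_i + b  in the
   unknowns x_0, x_1, ...; the bound k may vary within a system. *)
Record equation (M : nmodType) := Equation {
  eq_arity : nat;
  eq_lcoef : 'I_eq_arity -> nat;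
  eq_rcoef : 'I_eq_arity -> nat;
  eq_lparam : M;
  eq_rparam : M
}.

(* [x] solves [e] in [B], the parameters of [e] being read in [B] through
   [f]. *)
Definition solves (M B : nmodType) (f : M -> B) (x : nat -> B)
    (e : equation M) : Prop :=
  \sum_(i < eq_arity e) x i *+ eq_lcoef i + f (eq_lparam e) =
  \sum_(i < eq_arity e) x i *+ eq_rcoef i + f (eq_rparam e).

Definition solvable_via (M B : nmodType) (f : M -> B)
    (S : seq (equation M)) : Prop :=
  exists x : nat -> B, List.Forall (solves f x) S.

(* Extensions of [M] are taken up to isomorphism, as embeddings [f] of [M]
   into a monoid [B] of the class. *)
Definition unitarily_closed (C : nmodType -> Prop) (M : nmodType) : Prop :=
  forall (S : seq (equation M)) (B : nmodType) (f : {additive M -> B}),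
    C B -> unitary f -> solvable_via f S -> solvable_via (@id M) S.

Definition strongly_unitarily_closed (C : nmodType -> Prop) (M : nmodType) :
    Prop :=
  forall (S : seq (equation M)) (B : nmodType) (f : {additive M -> B}),
    C B -> strongly_unitary f -> solvable_via f S -> solvable_via (@id M) S.

(* Main.v *)
(* Given a relation to be realised in [M], adjoin formal solutions to [M] and
   quotient by the largest congruence under which the formal sums that the
   relation forces to lie in [M] are compared by their values in [M].  Every
   other sum becomes such a sum after adding a suitable formal element, so laws
   such as cancellativity and separativity pass from [M] to the quotient.
   - For a refinement of [a0 + a1 = b0 + b1], grade the four formal elements by
     [c00, c11] of degree 1 and [c01, c10] of degree -1: a sum of degree 0 can
     be grouped into pairs with sums among the [ai] and [bi], and its value does
     not depend on the grouping because [a0 + a1 = b0 + b1].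
   - For divisibility of [a] by [p], adjoin one element [u]: the sum [m + n u]
     lies in [M] when [p] divides [n].  If [x + a = y + a] then [x + u = y + u],
     since any multiple of [u] that completes [x + u] to an element of [M]
     contributes at least one [a].
   The extension is a cone unless some of the given elements vanish, in which
   case the solution in [M] is trivial. *)

From HB Require Import structures.
Require Import Defs.
From mathcomp Require Import all_boot all_algebra.
From mathcomp Require Import boolp zify.

Set Implicit Arguments.
Unset Strict Implicit.
Unset Printing Implicit Defensive.

Import GRing.Theory.
Local Open Scope ring_scope.
Local Open Scope quotient_scope.

(* [adj] below is the quotient of [M * N] in which the members [n] of the
   submonoid [D] are identified with their values [w n] in [M]. *)
Record weight (M N : nmodType) (D : pred N) (w : N -> M) : Prop := Weight {
  weight_in0 : D 0;
  weight_inD : forall n k, D n -> D k -> D (n + k);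
  weight_unitary : forall n k, D n -> D (n + k) -> D k;
  weight_cofinal : forall n, exists k, D (n + k);
  weight0 : w 0 = 0;
  weightD : forall n k, D n -> D k -> w (n + k) = w n + w k;
  weight_conical : forall n k, D (n + k) -> w (n + k) = 0 -> D n
}.

(** * The extension built from a weight, and the properties it inherits *)

Section Adjunction.

Variables (M N : nmodType) (D : pred N) (w : N -> M) (wP : weight D w).

(* The largest congruence that separates the elements of [M] and keeps
   [M * D] saturated.  Equalities in the quotient are thus tested in [M], which
   is why cancellativity and separativity of [M] are inherited. *)
Definition adj_rel (x y : M * N) : bool :=
  `[< forall k, D (x.2 + k) = D (y.2 + k) /\
      (D (x.2 + k) -> x.1 + w (x.2 + k) = y.1 + w (y.2 + k)) >].

Lemma adj_rel_refl : reflexive adj_rel.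
Proof. by move=> x; apply/asboolP. Qed.

Lemma adj_rel_sym : symmetric adj_rel.
Proof.
suff imp x y : adj_rel x y -> adj_rel y x.
  by move=> x y; apply/idP/idP; apply: imp.
move=> /asboolP exy; apply/asboolP => k; have [eD ev] := exy k.
by rewrite -eD; split=> // /ev.
Qed.

Lemma adj_rel_trans : transitive adj_rel.
Proof.
move=> y x z /asboolP exy /asboolP eyz; apply/asboolP => k.
have [eD ev] := exy k; have [eD' ev'] := eyz k.
by rewrite eD eD'; split=> // Dk; rewrite ev ?eD ?eD' // ev' ?eD'.
Qed.

Canonical adj_equiv := EquivRel adj_rel adj_rel_refl adj_rel_sym adj_rel_trans.

(* [wP] is a phantom argument: it lets the monoid structure on the quotient be
   inferred. *)
Definition adj of weight D w : Type := {eq_quot adj_equiv}.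
HB.instance Definition _ := Choice.on (adj wP).

Definition adj_class (x : M * N) : adj wP := \pi_({eq_quot adj_equiv}) x.

Lemma adj_classP x y : adj_class x = adj_class y <->
  forall k, D (x.2 + k) = D (y.2 + k) /\
    (D (x.2 + k) -> x.1 + w (x.2 + k) = y.1 + w (y.2 + k)).
Proof.
by split=> [/eqquotP/asboolP //|exy]; apply/eqquotP/asboolP.
Qed.

Lemma adj_class_surj (b : adj wP) : exists x, b = adj_class x.
Proof. by exists (repr (b : {eq_quot adj_equiv})); rewrite /adj_class reprK. Qed.

Definition adj_add (b c : adj wP) : adj wP :=
  adj_class (repr (b : {eq_quot adj_equiv}) + repr (c : {eq_quot adj_equiv})).

Lemma adj_class_addl x y z :
  adj_class x = adj_class y -> adj_class (x + z) = adj_class (y + z).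
Proof.
move=> /adj_classP exy; apply/adj_classP => k /=.
have [eD ev] := exy (z.2 + k); rewrite -!(addrA _ z.2); split=> // /ev e.
by rewrite !(addrAC _ z.1) e.
Qed.

Lemma adj_class_add x y : adj_add (adj_class x) (adj_class y) = adj_class (x + y).
Proof.
have reprE z : adj_class (repr (adj_class z : {eq_quot adj_equiv})) = adj_class z.
  by rewrite /adj_class reprK.
by rewrite /adj_add (adj_class_addl _ (reprE x)) addrC
           (adj_class_addl _ (reprE y)) addrC.
Qed.

Lemma adj_addA : associative adj_add.
Proof.
move=> b c d; have [x ->] := adj_class_surj b; have [y ->] := adj_class_surj c.
by have [z ->] := adj_class_surj d; rewrite !adj_class_add addrA.
Qed.

Lemma adj_addC : commutative adj_add.
Proof.
move=> b c; have [x ->] := adj_class_surj b; have [y ->] := adj_class_surj c.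
by rewrite !adj_class_add addrC.
Qed.

Lemma adj_add0 : left_id (adj_class 0) adj_add.
Proof.
by move=> b; have [x ->] := adj_class_surj b; rewrite adj_class_add add0r.
Qed.

HB.instance Definition _ :=
  GRing.isNmodule.Build (adj wP) adj_addA adj_addC adj_add0.

Lemma adj_classD x y : adj_class (x + y) = adj_class x + adj_class y.
Proof. by rewrite -adj_class_add. Qed.

Lemma adj_classMn m n p : adj_class (m, n) *+ p = adj_class (m *+ p, n *+ p).
Proof. by elim: p => // p IHp; rewrite !mulrS IHp -adj_classD. Qed.

Definition adj_emb (m : M) : adj wP := adj_class (m, 0).

Fact adj_emb_is_nmod_morphism : nmod_morphism adj_emb.
Proof.
split=> // x y; rewrite /adj_emb -adj_classD.
by congr adj_class; congr pair; rewrite addr0.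
Qed.

HB.instance Definition _ := GRing.isNmodMorphism.Build M (adj wP)
  adj_emb adj_emb_is_nmod_morphism.

Lemma adj_class_emb m n : D n -> adj_class (m, n) = adj_emb (m + w n).
Proof.
move=> Dn; apply/adj_classP => k /=; rewrite add0r.
have eD : D (n + k) = D k.
  by apply/idP/idP=> [/(weight_unitary wP Dn)|/(weight_inD wP Dn)].
by split=> //; rewrite eD => Dk; rewrite (weightD wP) // addrA.
Qed.

Lemma adj_class_eq_emb m n a :
  adj_class (m, n) = adj_emb a -> D n /\ m + w n = a.
Proof.
move=> /adj_classP/(_ 0) /=; rewrite !addr0 (weight_in0 wP) (weight0 wP) addr0.
by case=> -> /(_ isT).
Qed.

Lemma adj_emb_inj : injective adj_emb.
Proof.
by move=> a b /adj_class_eq_emb[_]; rewrite (weight0 wP) addr0.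
Qed.

Lemma adj_unitary : unitary adj_emb.
Proof.
split=> [|b|a0 a1 b]; first exact: adj_emb_inj.
  have [[m n] ->] := adj_class_surj b; have [k Dnk] := weight_cofinal wP n.
  exists (m + w (n + k)), (adj_class (0, k)); rewrite -adj_classD /=.
  by rewrite -adj_class_emb //; congr adj_class; congr pair; rewrite addr0.
have [[m n] ->] := adj_class_surj b; rewrite -adj_classD.
move=> /adj_class_eq_emb[]; rewrite add0r => Dn _.
by exists (m + w n); rewrite adj_class_emb.
Qed.

Lemma adj_strongly_unitary :
  (forall m n, (0 < m)%N -> D (n *+ m) -> D n) -> strongly_unitary adj_emb.
Proof.
move=> Dtf; split=> [|p b p_gt0 [a]]; first exact: adj_unitary.
have [[m n] ->] := adj_class_surj b.
rewrite adj_classMn => /esym/adj_class_eq_emb[/(Dtf _ _ p_gt0) Dn _].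
by exists (m + w n); rewrite adj_class_emb.
Qed.

(** If a sum vanishes, its formal part has value 0, so [weight_conical] puts both formal summands in
    [D], and conicality of [M] applies. *)
Lemma adj_cone : is_cone M -> is_cone (adj wP).
Proof.
move=> coneM b c.
have [[m n] ->] := adj_class_surj b; have [[l k] ->] := adj_class_surj c.
rewrite -adj_classD -(raddf0 adj_emb) => /adj_class_eq_emb[Dnk /coneM[]].
move=> /coneM[/= m0 l0] /= wnk.
have Dn := weight_conical wP Dnk wnk; have Dk := weight_unitary wP Dn Dnk.
have [wn wk] : w n = 0 /\ w k = 0 by apply: coneM; rewrite -(weightD wP).
by rewrite !adj_class_emb // m0 l0 wn wk addr0 raddf0.
Qed.

Lemma adj_cancellative : cancellative M -> cancellative (adj wP).
Proof.
move=> cM b c d; have [x ->] := adj_class_surj b.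
have [y ->] := adj_class_surj c; have [z ->] := adj_class_surj d.
rewrite -!adj_classD => /adj_classP e; apply/adj_classP => k /=.
(* Completing [z.2] by [l] to a member of [D] makes [z] contribute an element of [M], which can be
   cancelled there. *)
have [l Dl] := weight_cofinal wP z.2.
have [] := e (k + l); rewrite /= ![_ + z.2 + _]addrACA.
have DE n : D (n + (z.2 + l)) = D n.
  apply/idP/idP=> [|Dn]; last exact: (weight_inD wP).
  by rewrite addrC; apply: (weight_unitary wP).
rewrite !DE => eD ev; split=> // Dx; have Dy := Dx; rewrite eD in Dy.
apply: (cM _ _ (z.1 + w (z.2 + l))).
by rewrite addrACA [RHS]addrACA -!(weightD wP) // ev.
Qed.

(** Testing both equations at [k + k] gives each of the two summands its own [k], which reduces the
    claim to separativity of [M]. *)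
Lemma adj_separative : separative M -> separative (adj wP).
Proof.
move=> sM b c; have [x ->] := adj_class_surj b.
have [y ->] := adj_class_surj c; rewrite !mulr2n -!adj_classD.
move=> /adj_classP e1 /adj_classP e2; apply/adj_classP => k.
have half (u v : N) : D (u + k) -> D (u + v + (k + k)) -> D (v + k).
  by rewrite addrACA; apply: (weight_unitary wP).
have eD : D (x.2 + k) = D (y.2 + k).
  have [e1D _] := e1 (k + k); have [e2D _] := e2 (k + k).
  rewrite /= in e1D e2D.
  apply/idP/idP => Dk.
    by apply: (half _ _ Dk); rewrite -e1D addrACA; apply: (weight_inD wP).
  apply: (half _ _ Dk).
  by rewrite [y.2 + _]addrC e2D addrACA; apply: (weight_inD wP).
split=> // Dx; have Dy := Dx; rewrite eD in Dy.
have val u v : D (u.2 + k) -> D (v.2 + k) ->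
    (u + v).1 + w ((u + v).2 + (k + k)) =
    (u.1 + w (u.2 + k)) + (v.1 + w (v.2 + k)).
  by move=> Du Dv; rewrite /= addrACA (weightD wP) // addrACA.
have [_ ev1] := e1 (k + k); have [_ ev2] := e2 (k + k).
apply: sM; rewrite mulr2n -!val //.
  by apply: ev1; rewrite /= addrACA; apply: (weight_inD wP).
by apply: ev2; rewrite /= addrACA; apply: (weight_inD wP).
Qed.

Lemma adj_in_class (C : nmodType -> Prop) :
  C = cancellative_cone \/ C = separative_cone -> C M -> C (adj wP).
Proof.
case=> -> [coneM]; first by split; [apply: adj_cone|apply: adj_cancellative].
by split; [apply: adj_cone|apply: adj_separative].
Qed.

End Adjunction.

(** * The weight for refinement *)

Section Refinement.

Variables (M : nmodType) (a0 a1 b0 b1 : M).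
Hypothesis (eab : a0 + a1 = b0 + b1).

(* [(i, j, k, l)] stands for [i c00 + j c01 + k c10 + l c11].  When it is
   balanced, its terms can be grouped in pairs, each of which sums to one of
   [a0], [a1], [b0], [b1]. *)
Definition balanced (n : nat * nat * nat * nat) : bool :=
  let: (i, j, k, l) := n in (i + l == j + k)%N.

(** The sum of [p] pairs [c00 + c01], [q] pairs [c00 + c10], [r] pairs [c01 + c11] and [s] pairs
    [c10 + c11]. *)
Definition pairing (p q r s : nat) : nat * nat * nat * nat :=
  (p + q, p + r, q + s, r + s)%N.

Definition pairing_value (p q r s : nat) : M :=
  a0 *+ p + b0 *+ q + (b1 *+ r + a1 *+ s).

(** Evaluates the grouping with as many pairs [c00 + c01] as possible. *)
Definition balanced_value (n : nat * nat * nat * nat) : M :=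
  let: (i, j, k, l) := n in let p := minn i j in
  pairing_value p (i - p) (j - p) (k - (i - p)).

Lemma pairing_value_shift p q r s d :
  pairing_value (p + d) q r (s + d) = pairing_value p (q + d) (r + d) s.
Proof.
rewrite /pairing_value !mulrnDr [a0 *+ p + _ + _]addrAC [b1 *+ r + (_ + _)]addrA.
rewrite addrACA -mulrnDl eab mulrnDl.
by rewrite [b1 *+ r + _ + _]addrAC [a0 *+ p + (_ + _)]addrA [RHS]addrACA.
Qed.

(** Trading [minn q r] copies of [b0 + b1] for [a0 + a1] turns any grouping into the one used by
    [balanced_value]. *)
Lemma balanced_value_pairing p q r s :
  balanced_value (pairing p q r s) = pairing_value p q r s.
Proof.
rewrite /= -addn_minr; set d := minn q r.
have [dq dr] : (d <= q /\ d <= r)%N by rewrite geq_minl geq_minr.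
transitivity (pairing_value (p + d) (q - d) (r - d) (s + d)).
  by congr pairing_value; lia.
by rewrite pairing_value_shift !subnK.
Qed.

Lemma balancedP n : balanced n -> exists p q r s, n = pairing p q r s.
Proof.
case: n => [[[i j] k] l] /= /eqP e.
exists (minn i j), (i - minn i j)%N, (j - minn i j)%N, (k - (i - minn i j))%N.
by rewrite /pairing; congr (_, _, _, _); lia.
Qed.

Lemma pairingD p q r s p' q' r' s' :
  pairing p q r s + pairing p' q' r' s' =
  pairing (p + p') (q + q') (r + r') (s + s').
Proof. by rewrite /pairing; congr (_, _, _, _) => /=; rewrite addnACA. Qed.

Lemma pairing_valueD p q r s p' q' r' s' :
  pairing_value (p + p') (q + q') (r + r') (s + s') =
  pairing_value p q r s + pairing_value p' q' r' s'.
Proof.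
rewrite /pairing_value !mulrnDr [RHS]addrACA.
by congr (_ + _); rewrite addrACA.
Qed.

Lemma balanced_weight : is_cone M ->
  a0 != 0 -> a1 != 0 -> b0 != 0 -> b1 != 0 -> weight balanced balanced_value.
Proof.
move=> coneM a0n a1n b0n b1n.
have mul0 (a : M) p : a != 0 -> a *+ p = 0 -> p = 0%N.
  by case: p => // p /eqP a_n0; rewrite mulrS => /coneM[].
split=> //.
- by move=> [[[i j] k] l] [[[i' j'] k'] l'] /= /eqP e /eqP e'; apply/eqP; lia.
- by move=> [[[i j] k] l] [[[i' j'] k'] l'] /= /eqP e /eqP e'; apply/eqP; lia.
(* The added element has the opposite degree, [j + k - (i + l)]. *)
- move=> [[[i j] k] l]; exists (j + k, i + l, 0, 0)%N => /=; apply/eqP; lia.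
- by rewrite (balanced_value_pairing 0 0 0 0) /pairing_value !mulr0n !addr0.
- move=> n n' /balancedP[p [q [r [s ->]]]] /balancedP[p' [q' [r' [s' ->]]]].
  by rewrite pairingD !balanced_value_pairing pairing_valueD.
(* As the four parameters are nonzero, value 0 forces an empty grouping, hence [n = 0]. *)
move=> n n' /balancedP[p [q [r [s e]]]].
rewrite e balanced_value_pairing.
move=> /coneM[/coneM[/(mul0 _ _ a0n) p0 /(mul0 _ _ b0n) q0]].
move=> /coneM[/(mul0 _ _ b1n) r0 /(mul0 _ _ a1n) s0].
move: e; rewrite p0 q0 r0 s0; case: n => [[[i j] k] l].
by case: n' => [[[i' j'] k'] l'] /= [????]; apply/eqP; lia.
Qed.

Lemma balanced_torsion_free p n : (0 < p)%N -> balanced (n *+ p) -> balanced n.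
Proof.
move=> p_gt0; case: n => [[[i j] k] l].
have -> : (i, j, k, l) *+ p = (i * p, j * p, k * p, l * p)%N.
  by elim: p {p_gt0} => [|p IHp]; rewrite ?muln0 // mulrS IHp !mulnS.
by rewrite /= -!mulnDl eqn_pmul2r.
Qed.

End Refinement.

(** * Refinement in strongly unitarily closed monoids *)

Definition refinement_system (M : nmodType) (a0 a1 b0 b1 : M) :
    seq (equation M) :=
  let eqn (s : seq nat) (a : M) :=
    @Equation M 4 (fun i => nth 0%N s i) (fun=> 0%N) 0 a in
  [:: eqn [:: 1; 1; 0; 0]%N a0; eqn [:: 0; 0; 1; 1]%N a1;
      eqn [:: 1; 0; 1; 0]%N b0; eqn [:: 0; 1; 0; 1]%N b1].

Lemma solves_refinement_system (M B : nmodType) (f : M -> B) (x : nat -> B)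
    (a0 a1 b0 b1 : M) : f 0 = 0 ->
  List.Forall (solves f x) (refinement_system a0 a1 b0 b1) <->
  [/\ f a0 = x 0%N + x 1%N, f a1 = x 2%N + x 3%N,
      f b0 = x 0%N + x 2%N & f b1 = x 1%N + x 3%N].
Proof.
move=> f0; rewrite /refinement_system !List.Forall_cons_iff /solves /=.
rewrite !big_ord_recl !big_ord0 /= f0 !mulr0n !mulr1n !(addr0, add0r).
by split=> [[-> [-> [-> [-> _]]]] //|[-> -> -> ->]]; do !split=> //.
Qed.

Lemma strongly_unitarily_closed_refinement (C : nmodType -> Prop)
    (M : nmodType) : C = cancellative_cone \/ C = separative_cone ->
  C M -> strongly_unitarily_closed C M -> refinement_cone M.
Proof.
move=> hC CM closedM; have coneM : is_cone M by case: hC CM => -> [].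
split=> // a0 a1 b0 b1 eab.
have [a0_0|a0_n0] := eqVneq a0 0.
  by exists 0, 0, b0, b1; split; rewrite ?add0r // -eab a0_0 add0r.
have [a1_0|a1_n0] := eqVneq a1 0.
  by exists b0, b1, 0, 0; split; rewrite ?addr0 // -eab a1_0 addr0.
have [b0_0|b0_n0] := eqVneq b0 0.
  by exists 0, a0, 0, a1; split; rewrite ?add0r // eab b0_0 add0r.
have [b1_0|b1_n0] := eqVneq b1 0.
  by exists a0, 0, a1, 0; split; rewrite ?addr0 // eab b1_0 addr0.
have wP := balanced_weight eab coneM a0_n0 a1_n0 b0_n0 b1_n0.
have [|||x] := closedM (refinement_system a0 a1 b0 b1) (adj wP) (adj_emb wP).
- exact: adj_in_class.
- by apply: adj_strongly_unitary => p n; apply: balanced_torsion_free.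
(* The formal elements [c00], [c01], [c10], [c11], in the order of the unknowns. *)
- pose c := [:: (1, 0, 0, 0); (0, 1, 0, 0); (0, 0, 1, 0); (0, 0, 0, 1)]%N.
  exists (fun i => adj_class wP (0, nth 0 c i)).
  apply/(solves_refinement_system _ _ _ _ _ (raddf0 _)).
  have pairE p q r s n n' a : n + n' = pairing p q r s ->
      pairing_value a0 a1 b0 b1 p q r s = a ->
      adj_emb wP a = adj_class wP (0, n) + adj_class wP (0, n').
    move=> e <-; rewrite -adj_classD.
    rewrite -[RHS]/(adj_class wP (0 + 0, n + n')) e addr0.
    rewrite adj_class_emb ?(balanced_value_pairing eab) ?add0r //.
    by apply/eqP; lia.
  split.
  + apply: (pairE 1 0 0 0)%N => //.
    by rewrite /pairing_value !mulr0n mulr1n !addr0.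
  + apply: (pairE 0 0 0 1)%N => //.
    by rewrite /pairing_value !mulr0n mulr1n !add0r.
  + apply: (pairE 0 1 0 0)%N => //.
    by rewrite /pairing_value !mulr0n mulr1n !(addr0, add0r).
  + apply: (pairE 0 0 1 0)%N => //.
    by rewrite /pairing_value !mulr0n mulr1n !(addr0, add0r).
move=> /(solves_refinement_system _ _ _ _ _ erefl)[? ? ? ?].
by exists (x 0%N), (x 1%N), (x 2%N), (x 3%N).
Qed.

(** * Normal divisibility in unitarily closed monoids *)

Lemma divisor_weight (M : nmodType) (a : M) (p : nat) : is_cone M ->
  a != 0 -> (0 < p)%N ->
  @weight M nat (fun n => p %| n)%N (fun n => a *+ (n %/ p)).
Proof.
move=> coneM a_n0 p_gt0; split=> //.
- by move=> n k; apply: dvdn_add.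
- by move=> n k pn; rewrite -(dvdn_addr k pn).
- by move=> n; exists (n * p.-1)%N;
    rewrite -[_ + _]/(n + n * p.-1)%N -mulnS prednK // dvdn_mull.
- by rewrite div0n.
- by move=> n k pn _; rewrite divnDl // mulrnDr.
move=> n k /dvdnP[[|q] e]; rewrite [_ + _]e mulnK //.
  by move: e => /eqP; rewrite addn_eq0 => /andP[/eqP ->]; rewrite dvdn0.
by rewrite mulrS => /coneM[/eqP]; rewrite (negPf a_n0).
Qed.

Definition divisibility_system (M : nmodType) (p : nat) (a : M) (s : seq (M * M)) :
    seq (equation M) :=
  @Equation M 1 (fun=> p) (fun=> 0%N) 0 a ::
  [seq @Equation M 1 (fun=> 1%N) (fun=> 1%N) xy.1 xy.2 | xy <- s].

Lemma solves_divisibility_system (M B : nmodType) (f : M -> B) (x : nat -> B)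
    (p : nat) (a : M) (s : seq (M * M)) : f 0 = 0 ->
  List.Forall (solves f x) (divisibility_system p a s) <->
  x 0%N *+ p = f a /\ {in s, forall xy, f xy.1 + x 0%N = f xy.2 + x 0%N}.
Proof.
move=> f0; rewrite /divisibility_system List.Forall_cons_iff /solves /=.
rewrite !big_ord1 f0 mulr0n !(addr0, add0r).
suff -> : List.Forall (solves f x)
      [seq @Equation M 1 (fun=> 1%N) (fun=> 1%N) xy.1 xy.2 | xy <- s] <->
    {in s, forall xy, f xy.1 + x 0%N = f xy.2 + x 0%N} by [].
elim: s => [|xy s IHs] /=; first by split=> // _; apply: List.Forall_nil.
rewrite List.Forall_cons_iff {}IHs /solves /= !big_ord1 !mulr1n.
rewrite ![x 0%N + _]addrC; split=> [[exy es] zt|es].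
  by rewrite inE => /predU1P[->|/es].
split=> [|zt zts]; first by apply: es; rewrite mem_head.
by apply: es; rewrite inE zts orbT.
Qed.

Lemma unitarily_closed_normally_divisible (C : nmodType -> Prop)
    (M : nmodType) : C = cancellative_cone \/ C = separative_cone ->
  C M -> unitarily_closed C M -> normally_divisible M.
Proof.
move=> hC CM closedM p X a p_gt0; have coneM : is_cone M by case: hC CM => -> [].
have [->|a_n0] := eqVneq a 0; first by exists 0; rewrite mul0rn.
have wP := divisor_weight coneM a_n0 p_gt0.
(* Normality amounts to finitely many equations, one for each pair from [X] identified by adding
   [a]. *)
pose s := [seq xy <- [seq (x, y) | x <- X, y <- X] | xy.1 + a == xy.2 + a].
have [|||x] := closedM (divisibility_system p a s) (adj wP) (adj_emb wP).
- exact: adj_in_class.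
- exact: adj_unitary.
- exists (fun=> adj_class wP (0, 1%N)).
  apply/(solves_divisibility_system _ _ _ _ (raddf0 _)); split=> [|[y z]].
    rewrite adj_classMn mul0rn natn.
    by rewrite adj_class_emb // divnn p_gt0 add0r mulr1n.
  rewrite mem_filter => /andP[/eqP /= eyz _].
  rewrite -!adj_classD; apply/adj_classP => k /=; split=> // /dvdnP[[|q]] //= e.
  rewrite !addr0 !add0r [(1 + k)%R]e mulnK // mulrS.
  by rewrite !addrA eyz.
move=> /(solves_divisibility_system _ _ _ _ erefl)[xp xs].
exists (x 0%N); split=> // y z yX zX eyz; apply: (xs (y, z)).
by rewrite mem_filter /= eyz eqxx allpairs_f.
Qed.

Theorem theorem1p9 (C : nmodType -> Prop)
    (hC : C = cancellative_cone \/ C = separative_cone)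
    (M : nmodType) (hM : C M) (hsuc : strongly_unitarily_closed C M) :
  refinement_cone M /\ (unitarily_closed C M -> normally_divisible M).
Proof.
split; first exact: strongly_unitarily_closed_refinement hsuc.
exact: unitarily_closed_normally_divisible.
Qed.
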